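(* Let $A\in\mathbb K^{n_1\times\dots\times n_d}$ be a nonzero tensor with TT-singular values $\sigma=(\sigma^{(1)},\dots,\sigma^{(d-1)})$, let $r_\mu=\deg(\sigma^{(\mu)})$ for $\mu=1,\dots,d-1$, $r_0=r_d=1$, and let $\Sigma^{(\mu)}=\mathrm{diag}(\sigma^{(\mu)}_+)\in\mathbb R^{r_\mu\times r_\mu}$ be the square diagonal matrices containing the positive TT-singular values of $A$. Then there exist cores $\mathcal G_\mu\in(\mathbb K^{r_{\mu-1}\times r_\mu})^{\{1,\dots,n_\mu\}}$, $\mu=1,\dots,d$, such that: (1) for each $\mu=1,\dots,d-1$, $$\mathfrak L\big(\mathcal G_1\boxtimes\Sigma^{(1)}\mathcal G_2\boxtimes\dots\boxtimes\Sigma^{(\mu-1)}\mathcal G_\mu\big)\;\Sigma^{(\mu)}\;\mathfrak R\big(\mathcal G_{\mu+1}\Sigma^{(\mu+1)}\boxtimes\dots\boxtimes\mathcal G_d\big)$$ is a truncated singular value decomposition of $A^{(\{1,\dots,\mu\})}$. These cores are essentially unique: if $\widetilde{\mathcal G}_1,\dots,\widetilde{\mathcal G}_d$ is any other such family of cores with property (1), then $\widetilde{\mathcal G}_\mu=w_{\mu-1}^H\,\mathcal G_\mu\,w_\mu$ for $\mu=1,\dots,d$, where each $w_\mu\in\mathbb K^{r_\mu\times r_\mu}$, $\mu=1,\dots,d-1$, is a unitary matrix that commutes with $\Sigma^{(\mu)}$, and $w_0=w_d=1$.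
   Context: $\mathbb K\in\{\mathbb R,\mathbb C\}$; for $\mathbb K=\mathbb R$ unitary means orthogonal and $\cdot^H$ is the transpose. $A^{(\{1,\dots,\mu\})}\in\mathbb K^{n_1\cdots n_\mu\times n_{\mu+1}\cdots n_d}$ is the matricization with entries $A^{(\{1,\dots,\mu\})}((i_1,\dots,i_\mu),(i_{\mu+1},\dots,i_d))=A(i_1,\dots,i_d)$, multi-indices being enumerated co-lexicographically. The TT-singular values are $\sigma^{(\mu)}=\mathrm{sv}(A^{(\{1,\dots,\mu\})})$, the weakly decreasing sequence of singular values extended by zeros. $\deg(v)$ is the number of positive entries of $v$ and $v_+$ is the tuple of these positive entries. A core $H\in(\mathbb K^{k_1\times k_2})^{\{1,\dots,m\}}$ is an array of $m$ matrices $H(i)\in\mathbb K^{k_1\times k_2}$. The product of cores is $(H\boxtimes N)(i,j)=H(i)N(j)$, whose index set consists of the pairs $(i,j)$ enumerated co-lexicographically. Products of a core with a matrix are taken entrywise in $i$: $(MH)(i)=MH(i)$, $(HM)(i)=H(i)M$. The left unfolding is $\mathfrak L(H)\in\mathbb K^{k_1m\times k_2}$, $\mathfrak L(H)_{(\ell,j),q}=H(j)_{\ell,q}$ (matrices stacked in one column), and the right unfolding is $\mathfrak R(H)\in\mathbb K^{k_1\times k_2m}$, $\mathfrak R(H)_{\ell,(q,j)}=H(j)_{\ell,q}$ (matrices side by side in one row). A truncated SVD of a matrix $M$ of rank $r$ is a factorization $M=U\Sigma V^H$ where $U,V$ have $r$ orthonormal columns and $\Sigma$ is the $r\times r$ diagonal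 matrix of the positive singular values in weakly decreasing order. *)

(* Defs.v *)
From HB Require Import structures.
From mathcomp Require Import all_boot all_order all_algebra.
From mathcomp Require Import complex reals.

Set Implicit Arguments.
Unset Strict Implicit.
Unset Printing Implicit Defensive.

Import Order.TTheory GRing.Theory Num.Theory.

Local Open Scope ring_scope.

Variant scalar_kind := RealScalars | ComplexScalars.

Definition scalar_field (R : rcfType) (k : scalar_kind) : numFieldType :=
  match k with RealScalars => R | ComplexScalars => R[i] end.

Definition conj_scalar (R : rcfType) (k : scalar_kind) :
    scalar_field R k -> scalar_field R k :=
  match k with RealScalars => fun x => x | ComplexScalars => @conjc R end.

Definition of_real (R : rcfType) (k : scalar_kind) : R -> scalar_field R k :=
  match k with RealScalars => fun x => x | ComplexScalars => real_complex R end.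

(* Co-lexicographic enumeration of pairs: (a, b) with a < m1 and b < m2 has
   position a + m1 * b, the first component varying fastest. *)
Lemma colex_fst_subproof m1 m2 (t : 'I_(m1 * m2)) : (t %% m1 < m1)%N.
Proof.
by case: m1 t => [|m1] [t lt_t] /=; [rewrite mul0n in lt_t | rewrite ltn_pmod].
Qed.

Lemma colex_snd_subproof m1 m2 (t : 'I_(m1 * m2)) : (t %/ m1 < m2)%N.
Proof.
case: m1 t => [|m1] [t lt_t] /=; first by rewrite mul0n in lt_t.
by rewrite ltn_divLR // mulnC.
Qed.

Definition colex_fst m1 m2 (t : 'I_(m1 * m2)) : 'I_m1 :=
  Ordinal (colex_fst_subproof t).

Definition colex_snd m1 m2 (t : 'I_(m1 * m2)) : 'I_m2 :=
  Ordinal (colex_snd_subproof t).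

(* A finite weakly decreasing list stands for the sequence obtained by
   extending it by zeros; s`_i is 0 beyond its length. *)
Definition pos_part (R : realDomainType) (s : seq R) : seq R :=
  [seq x <- s | 0 < x].

Definition deg (R : realDomainType) (s : seq R) : nat :=
  count (fun x => 0 < x) s.

(* Modes are numbered 0, ..., d - 1 and bonds 0, ..., d, so that mode mu lies
   between the bonds mu and mu + 1.  Families indexed by modes or bonds are
   functions on nat whose values outside these ranges are irrelevant. *)
Definition tt_rank (R : realDomainType) (d : nat) (sigma : nat -> seq R)
    (mu : nat) : nat :=
  if (mu == 0%N) || (mu == d) then 1%N else deg (sigma mu).

Lemma tt_rank_last (R : realDomainType) d (sigma : nat -> seq R) :
  tt_rank d sigma d = 1%N.
Proof. by rewrite /tt_rank eqxx orbT. Qed.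

(* The i-th component of the multi-index whose components below mu are the
   co-lexicographic digits of t and whose components from mu on are those
   of u. *)
Definition multi_digit (n : nat -> nat) (mu t u i : nat) : nat :=
  if (i < mu)%N then ((t %/ \prod_(0 <= j < i) n j) %% n i)%N
  else ((u %/ \prod_(mu <= j < i) n j) %% n i)%N.

Lemma multi_digit_subproof (n : nat -> nat) (d mu : nat)
    (t : 'I_(\prod_(0 <= i < mu) n i)) (u : 'I_(\prod_(mu <= i < d) n i))
    (i : 'I_d) :
  (multi_digit n mu t u i < n i)%N.
Proof.
rewrite /multi_digit; case: (ltnP i mu) => [lt_i_mu | le_mu_i]; apply: ltn_pmod.
  have := leq_ltn_trans (leq0n t) (ltn_ord t).
  by rewrite (big_cat_nat (n := i) (leq0n i) (ltnW lt_i_mu)) muln_gt0 /=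
             (big_ltn lt_i_mu) muln_gt0 => /and3P[].
have := leq_ltn_trans (leq0n u) (ltn_ord u).
by rewrite (big_cat_nat (n := i) le_mu_i (ltnW (ltn_ord i))) muln_gt0 /=
           (big_ltn (ltn_ord i)) muln_gt0 => /and3P[].
Qed.

Definition multi_index (n : nat -> nat) (d mu : nat)
    (t : 'I_(\prod_(0 <= i < mu) n i)) (u : 'I_(\prod_(mu <= i < d) n i)) :
    {dffun forall i : 'I_d, 'I_(n i)} :=
  [ffun i : 'I_d => Ordinal (multi_digit_subproof t u i)].

(* The number of index tuples of k consecutive modes starting with mode s. *)
Fixpoint chain_size (n : nat -> nat) (s k : nat) : nat :=
  if k is k'.+1 then (chain_size n s k' * n (k' + s))%N else 1%N.

Lemma chain_sizeE n s k : chain_size n s k = (\prod_(s <= i < k + s) n i)%N.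
Proof.
elim: k => [|k IHk] /=; first by rewrite big_geq.
by rewrite IHk addSn big_nat_recr ?leq_addl.
Qed.

Section Scalars.

Variables (R : rcfType) (k : scalar_kind).
Local Notation K := (scalar_field R k).

Definition conj_mx m n (M : 'M[K]_(m, n)) : 'M[K]_(n, m) :=
  map_mx (@conj_scalar R k) M^T.

Definition orthonormal_cols m n (U : 'M[K]_(m, n)) : Prop :=
  conj_mx U *m U = 1%:M.

Definition unitary n (W : 'M[K]_n) : Prop :=
  conj_mx W *m W = 1%:M /\ W *m conj_mx W = 1%:M.

(* The squares of the entries of s are the eigenvalues of M^H M, with
   multiplicity. *)
Definition singular_values m n (M : 'M[K]_(m, n)) (s : seq R) : Prop :=
  [/\ sorted >=%R s,
      all (fun x => 0 <= x) s
    & char_poly (conj_mx M *m M)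
        = \prod_(x <- s) ('X - (of_real k (x ^+ 2))%:P)].

Definition diag_pos r (s : seq R) : 'M[K]_r :=
  diag_mx (\row_(i < r) of_real k (pos_part s)`_i).

Definition truncated_svd m n r (M : 'M[K]_(m, n))
    (U : 'M[K]_(m, r)) (S : 'M[K]_r) (V : 'M[K]_(n, r)) : Prop :=
  [/\ r = \rank M,
      M = U *m S *m conj_mx V,
      orthonormal_cols U,
      orthonormal_cols V
    & exists2 s, singular_values M s & deg s = r /\ S = diag_pos r s].

Definition tensor (d : nat) (n : nat -> nat) :=
  {ffun {dffun forall i : 'I_d, 'I_(n i)} -> K}.

Definition matricization d n (mu : nat) (A : tensor d n) :
    'M[K]_(\prod_(0 <= i < mu) n i, \prod_(mu <= i < d) n i) :=
  \matrix_(t, u) A (multi_index t u).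

Definition tt_singular_values d n (A : tensor d n) (sigma : nat -> seq R) :
    Prop :=
  forall mu, (0 < mu < d)%N -> singular_values (matricization mu A) (sigma mu).

Definition core (m k1 k2 : nat) := 'I_m -> 'M[K]_(k1, k2).

Definition boxprod m1 m2 k1 k2 k3 (H : core m1 k1 k2) (N : core m2 k2 k3) :
    core (m1 * m2) k1 k3 :=
  fun t => H (colex_fst t) *m N (colex_snd t).

Definition mulmx_core m k1 k2 k3 (M : 'M[K]_(k1, k2)) (H : core m k2 k3) :
    core m k1 k3 :=
  fun i => M *m H i.

Definition mulcore_mx m k1 k2 k3 (H : core m k1 k2) (M : 'M[K]_(k2, k3)) :
    core m k1 k3 :=
  fun i => H i *m M.

Definition left_unfolding m k1 k2 (H : core m k1 k2) : 'M[K]_(k1 * m, k2) :=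
  \matrix_(t, q) H (colex_snd t) (colex_fst t) q.

Definition right_unfolding m k1 k2 (H : core m k1 k2) : 'M[K]_(k1, k2 * m) :=
  \matrix_(l, t) H (colex_snd t) l (colex_fst t).

(* H s [x] H s.+1 [x] ... [x] H (s + k - 1), the empty product being the core
   with the single matrix 1. *)
Fixpoint chain (n r : nat -> nat) (H : forall i, core (n i) (r i) (r i.+1))
    (s l : nat) : core (chain_size n s l) (r s) (r (l + s)) :=
  match l return core (chain_size n s l) (r s) (r (l + s)) with
  | 0 => fun _ : 'I_1 => 1%:M : 'M_(r s)
  | l'.+1 => boxprod (@chain n r H s l') (H (l' + s)%N)
  end.

Arguments chain {n r} H s l _.

Section Cores.

Variables (d : nat) (n : nat -> nat) (sigma : nat -> seq R).
Local Notation r := (tt_rank d sigma).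

Definition cores := forall mu : nat, core (n mu) (r mu) (r mu.+1).

Definition Sigma (mu : nat) : 'M[K]_(r mu) := diag_pos (r mu) (sigma mu).

Definition left_factor (G : cores) (i : nat) : core (n i) (r i) (r i.+1) :=
  if i == 0%N then G i else mulmx_core (Sigma i) (G i).

Definition right_factor (G : cores) (i : nat) : core (n i) (r i) (r i.+1) :=
  if i.+1 == d then G i else mulcore_mx (G i) (Sigma i.+1).

Arguments left_factor G i _ : clear implicits.
Arguments right_factor G i _ : clear implicits.

Lemma left_dim mu : (r 0 * chain_size n 0 mu = \prod_(0 <= i < mu) n i)%N.
Proof. by rewrite mul1n chain_sizeE addn0. Qed.

Lemma right_dim mu : (mu <= d)%N ->
  (r (d - mu + mu) * chain_size n mu (d - mu) = \prod_(mu <= i < d) n i)%N.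
Proof. by move=> le_mu_d; rewrite chain_sizeE subnK // tt_rank_last mul1n. Qed.

(* The casts in the next two definitions only identify equal dimensions. *)
Definition left_interface (G : cores) (mu : nat) :
    'M[K]_(\prod_(0 <= i < mu) n i, r mu) :=
  castmx (left_dim mu, congr1 r (addn0 mu))
    (left_unfolding (chain (left_factor G) 0 mu)).

Definition right_interface (G : cores) (mu : nat) (le_mu_d : (mu <= d)%N) :
    'M[K]_(r mu, \prod_(mu <= i < d) n i) :=
  castmx (erefl (r mu), right_dim le_mu_d)
    (right_unfolding (chain (right_factor G) mu (d - mu))).

(* truncated_svd takes V, while the right interface is V^H. *)
Definition tt_svd (A : tensor d n) (G : cores) : Prop :=
  forall mu, (0 < mu)%N -> forall lt_mu_d : (mu < d)%N,
    truncated_svd (matricization mu A)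
      (left_interface G mu) (Sigma mu)
      (conj_mx (right_interface G (ltnW lt_mu_d))).

End Cores.

End Scalars.

(* Main.v *)
Require Import Defs.
From HB Require Import structures.
From mathcomp Require Import all_boot all_order all_algebra.
From mathcomp Require Import complex reals boolp ring.

Set Implicit Arguments.
Unset Strict Implicit.
Unset Printing Implicit Defensive.

Import Order.TTheory GRing.Theory Num.Theory.

Local Open Scope ring_scope.

(** Write M_mu for the matricization of A that separates the first mu modes
from the others, with the convention M_mu = U_mu T_mu V_mu, where
T_mu = Sigma^(mu) at an inner bond and T_mu = 1 at the two ends; there
U_0 = 1, V_0 = M_0 and U_d = M_d, V_d = 1.  Here V_mu already stands for the
conjugate transpose.  Everything rests on one remark: fixing the index i of
mode mu selects some rows of M_(mu+1) and some columns of M_mu, and these two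
submatrices are equal (matricization_shift).  The products of cores obey the
same pattern.  The rows of the left interface at mu+1 with index i are
U_mu T_mu G_mu(i) (left_interface_snoc), and the columns of the right
interface at mu with index i are G_mu(i) T_(mu+1) V_(mu+1)
(right_interface_cons).

Existence: choose any truncated singular value decompositions of the M_mu and
read the core off the left recursion, G_mu(i) = T_mu^-1 U_mu^H (U_(mu+1))_i,
where (-)_i are the rows with index i.  The column space of (U_(mu+1))_i lies
in that of M_mu, hence in that of U_mu, and so the left recursion reproduces
U_(mu+1) (svd_cores_left).  The right recursion reproduces V_mu, because
(U_(mu+1))_i T_(mu+1) V_(mu+1) consists of rows of M_(mu+1), that is of columns
of M_mu = U_mu T_mu V_mu (svd_cores_right).

Uniqueness: two truncated singular value decompositions of one matrix with the
same Sigma differ by a unitary w which commutes with Sigma and acts on both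
sides (svd_unique).  Comparing the recursions of the two families of cores and
cancelling the orthonormal factors and the weights gives the gauge relation
(tt_svd_unique).

The decompositions themselves come from the spectral theorem for M^H M
(hermitian_spectral), proved for both scalar fields at once: the given
factorization of the characteristic polynomial supplies real eigenvalues,
already in decreasing order, and Householder reflections deflate them one by
one. *)

(** * Scalars and conjugation *)

Section ScalarTheory.

Variables (R : rcfType) (k : scalar_kind).
Local Notation K := (scalar_field R k).
Local Notation conj := (@conj_scalar R k).
Local Notation real := (@of_real R k).

Lemma conj_scalar_additive : additive conj.
Proof. by case: k => x y //; exact: rmorphB. Qed.

Lemma conj_scalar_multiplicative : multiplicative conj.
Proof. by case: k; split=> //; [exact: rmorphM|exact: rmorph1]. Qed.

HB.instance Definition _ :=
  GRing.isZmodMorphism.Build K K conj conj_scalar_additive.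
HB.instance Definition _ :=
  GRing.isMultiplicative.Build K K conj conj_scalar_multiplicative.

Lemma of_real_additive : additive real.
Proof. by case: k => x y //; exact: rmorphB. Qed.

Lemma of_real_multiplicative : multiplicative real.
Proof. by case: k; split=> //; exact: rmorphM. Qed.

HB.instance Definition _ :=
  GRing.isZmodMorphism.Build R K real of_real_additive.
HB.instance Definition _ :=
  GRing.isMultiplicative.Build R K real of_real_multiplicative.

Lemma conj_scalarK : involutive conj.
Proof. by case: k => x //=; rewrite conjcK. Qed.

Lemma conj_of_real x : conj (real x) = real x.
Proof. by case: k => //=; exact: conjc_real. Qed.

Lemma conj_scalar1 : conj 1 = 1.
Proof. exact: rmorph1. Qed.

Lemma mul_conj_scalar_ge0 z : 0 <= conj z * z.
Proof. by case: k z => z /=; rewrite ?sqr_ge0 // mulrC mulcJ_ge0. Qed.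

Lemma ge0_of_real (z : K) : 0 <= z -> exists2 x, 0 <= x & z = real x.
Proof.
case: k z => z /= z0; first by exists z.
by case: z z0 => a b; rewrite lecE /= => /andP[/eqP -> a0]; exists a.
Qed.

(** * Conjugate transposes *)

Lemma conj_mxE m n (M : 'M[K]_(m, n)) i j : conj_mx M i j = conj (M j i).
Proof. by rewrite !mxE. Qed.

Lemma conj_mxK m n (M : 'M[K]_(m, n)) : conj_mx (conj_mx M) = M.
Proof. by apply/matrixP=> i j; rewrite !conj_mxE conj_scalarK. Qed.

Lemma conj_mxM m n p (M : 'M[K]_(m, n)) (N : 'M[K]_(n, p)) :
  conj_mx (M *m N) = conj_mx N *m conj_mx M.
Proof. by rewrite /conj_mx trmx_mul map_mxM. Qed.

Lemma conj_mxB m n (M N : 'M[K]_(m, n)) :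
  conj_mx (M - N) = conj_mx M - conj_mx N.
Proof. by rewrite /conj_mx linearB /= map_mxB. Qed.

Lemma conj_mx_scalar n (a : K) : conj_mx (a%:M : 'M_n) = (conj a)%:M.
Proof. by rewrite /conj_mx tr_scalar_mx map_scalar_mx. Qed.

Lemma conj_mx1 n : conj_mx (1%:M : 'M[K]_n) = 1%:M.
Proof. by rewrite conj_mx_scalar rmorph1. Qed.

Lemma conj_mxZ m n a (M : 'M[K]_(m, n)) :
  conj_mx (a *: M) = conj a *: conj_mx M.
Proof. by apply/matrixP=> i j; rewrite !mxE rmorphM. Qed.

Lemma conj_mx_pid m n r : conj_mx (pid_mx r : 'M[K]_(m, n)) = pid_mx r.
Proof. by rewrite /conj_mx tr_pid_mx map_pid_mx. Qed.

Lemma conj_mx_diag n (c : 'I_n -> R) :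
  conj_mx (diag_mx (\row_i real (c i))) = diag_mx (\row_i real (c i)).
Proof.
rewrite /conj_mx tr_diag_mx map_diag_mx; congr diag_mx.
by apply/rowP=> i; rewrite !mxE; exact: conj_of_real.
Qed.

Lemma gram_diagE m n (M : 'M[K]_(m, n)) j :
  (conj_mx M *m M) j j = \sum_i conj (M i j) * M i j.
Proof. by rewrite mxE; apply: eq_bigr => i _; rewrite conj_mxE. Qed.

Lemma gram_ge0 m n (M : 'M[K]_(m, n)) j : 0 <= (conj_mx M *m M) j j.
Proof. by rewrite gram_diagE sumr_ge0 // => i _; apply: mul_conj_scalar_ge0. Qed.

(** Diagonal entries of M^H M are sums of the nonnegative terms |M i j|^2. *)
Lemma gram_eq0 m n (M : 'M[K]_(m, n)) : conj_mx M *m M = 0 -> M = 0.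
Proof.
move=> M0; apply/matrixP=> i j; rewrite mxE.
have /eqP := gram_diagE M j; rewrite M0 mxE eq_sym psumr_eq0; last first.
  by move=> *; apply: mul_conj_scalar_ge0.
move/allP/(_ i); rewrite mem_index_enum => /(_ isT) /=.
rewrite mulf_eq0 => /orP[/eqP /(congr1 conj)|/eqP //].
by rewrite conj_scalarK rmorph0.
Qed.

Lemma unitaryM n (U V : 'M[K]_n) : unitary U -> unitary V -> unitary (U *m V).
Proof.
move=> [U1 U2] [V1 V2]; split; rewrite conj_mxM.
  by rewrite mulmxA -[_ *m U]mulmxA U1 mulmx1.
by rewrite mulmxA -[_ *m _ *m conj_mx V]mulmxA V2 mulmx1.
Qed.

Lemma orthonormal_unitary n (U : 'M[K]_n) : orthonormal_cols U -> unitary U.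
Proof. by move=> U1; split=> //; apply: mulmx1C. Qed.

(** The matrix 'X - W^H B W is W^H ('X - B) W over the polynomial ring, so the
determinants of W^H and W cancel. *)
Lemma char_poly_conj n (B W : 'M[K]_n) :
  unitary W -> char_poly (conj_mx W *m B *m W) = char_poly B.
Proof.
move=> [W1 W2]; rewrite /char_poly.
have -> : char_poly_mx (conj_mx W *m B *m W)
    = map_mx polyC (conj_mx W) *m char_poly_mx B *m map_mx polyC W.
  rewrite /char_poly_mx mulmxBr mulmxBl -!map_mxM; congr (_ - _).
  by rewrite scalar_mxC -mulmxA -map_mxM W1 map_mx1 mulmx1.
by rewrite !det_mulmx mulrAC -det_mulmx -map_mxM W1 map_mx1 det1 mul1r.
Qed.

(** * The spectral theorem *)

(** Besides the unit length, the phase is fixed: a reflection can carry the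
first unit vector only to unit vectors with a real first entry. *)
Lemma normalize n (v : 'cV[K]_n.+1) : v != 0 ->
  exists c, orthonormal_cols (c *: v) /\ conj ((c *: v) 0 0) = (c *: v) 0 0.
Proof.
move=> v0.
(* a * v 0 0 is |v 0 0| ^ 2, hence real. *)
pose a := if v 0 0 == 0 then 1 else conj (v 0 0).
have a0 : a != 0.
  rewrite /a; case: ifP => [_|/negbT]; first exact: oner_neq0.
  by rewrite fmorph_eq0.
pose y := a *: v.
have y00 : conj (y 0 0) = y 0 0.
  rewrite mxE /a; case: ifP => [/eqP ->|_]; first by rewrite mulr0 rmorph0.
  by rewrite rmorphM /= conj_scalarK mulrC.
have [x x0 ex] := ge0_of_real (gram_ge0 y 0).
have xn0 : x != 0.
  apply: contraNneq v0 => xz; rewrite xz rmorph0 in ex.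
  have /gram_eq0/eqP : conj_mx y *m y = 0 by rewrite [LHS]mx11_scalar ex raddf0.
  by rewrite scalemx_eq0 (negPf a0).
exists (real (Num.sqrt x)^-1 * a); rewrite -scalerA -/y; split; last first.
  by rewrite mxE rmorphM /= y00 conj_of_real.
rewrite /orthonormal_cols conj_mxZ conj_of_real -scalemxAl -scalemxAr scalerA.
rewrite -rmorphM -invfM -expr2 sqr_sqrtr // [_ *m _]mx11_scalar ex.
by rewrite scale_scalar_mx -rmorphM mulVf // rmorph1.
Qed.

(** The reflection along h = u - e exchanges the unit vectors u and e, where u
is the normalized v and e the first unit vector.  Its usual factor
2 / (h^H h) equals 1 / (1 - u 0 0), as u 0 0 is real. *)
Lemma householder n (v : 'cV[K]_n.+1) : v != 0 ->
  exists W : 'M[K]_n.+1, unitary W /\ exists c, W *m delta_mx 0 0 = c *: v.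
Proof.
move=> /normalize[c [u1 u00]]; set u := c *: v in u1 u00.
suff [W [Wu We]] : exists W : 'M[K]_n.+1, unitary W /\ W *m delta_mx 0 0 = u.
  by exists W; split=> //; exists c.
clearbody u; clear v c.
pose e : 'cV[K]_n.+1 := delta_mx 0 0; pose h : 'cV[K]_n.+1 := u - e.
have he : conj_mx h *m e = (u 0 0 - 1)%:M.
  by rewrite [LHS]mx11_scalar -colE !mxE eqxx rmorphB rmorph1 /= u00.
have ee : conj_mx e = delta_mx 0 0 by rewrite /conj_mx trmx_delta map_delta_mx.
have ch : conj_mx h *m h = (2 * (1 - u 0 0))%:M.
  rewrite {2}/h mulmxBr he /h conj_mxB mulmxBl u1 ee -rowE.
  apply/matrixP=> i j; rewrite !ord1 !mxE eqxx /= !mulr1n; ring.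
have [h0|h0] := eqVneq (1 - u 0 0) 0.
  have /gram_eq0/eqP : conj_mx h *m h = 0 by rewrite ch h0 mulr0 raddf0.
  rewrite subr_eq0 => /eqP ue; exists 1%:M; split; last by rewrite mul1mx.
  by split; rewrite conj_mx1 mulmx1.
pose W : 'M[K]_n.+1 := 1%:M - (1 - u 0 0)^-1 *: (h *m conj_mx h).
have WH : conj_mx W = W.
  rewrite conj_mxB conj_mx1 conj_mxZ conj_mxM conj_mxK fmorphV rmorphB.
  by rewrite /= conj_scalar1 u00.
have WW : W *m W = 1%:M.
  rewrite /W mulmxBl mul1mx mulmxBr mulmx1 -scalemxAl -scalemxAr.
  rewrite mulmxA -[h *m _ *m h]mulmxA ch mul_mx_scalar -scalemxAl !scalerA.
  rewrite opprB addrA -!addrA -!scaleNr -!scalerDl -[RHS]addr0.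
  congr (_ + _); rewrite -[RHS](scale0r (h *m conj_mx h)); congr (_ *: _).
  by rewrite [2 * _]mulrC mulKf // mulr2n mulrDr mulr1 addrK addNr.
exists W; split; first by split; rewrite WH.
rewrite -/e /W mulmxBl mul1mx -scalemxAl -mulmxA he mul_mx_scalar scalerA.
by rewrite -[u 0 0 - 1]opprB mulrN mulVf // scaleN1r opprK /h addrC subrK.
Qed.

(** The same fact in block form, which is the shape that deflation uses. *)
Lemma unitary_extension n (v : 'cV[K]_(1 + n)) : v != 0 ->
  exists2 W : 'M[K]_(1 + n), unitary W & exists c, lsubmx W = c *: v.
Proof.
move=> /householder[W [Wu [c We]]]; exists W => //; exists c.
rewrite -We -colE; apply/matrixP=> i j; rewrite ord1 !mxE.
by congr (W _ _); apply: val_inj.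
Qed.

Lemma unitary_block n (V : 'M[K]_n) :
  unitary V -> unitary (block_mx (1%:M : 'M_1) 0 0 V).
Proof.
move=> [V1 V2].
have VH : conj_mx (block_mx (1%:M : 'M_1) 0 0 V)
    = block_mx (1%:M : 'M_1) 0 0 (conj_mx V).
  by rewrite /conj_mx tr_block_mx map_block_mx !trmx0 !map_mx0 trmx1 map_mx1.
split; rewrite VH mulmx_block !mulmx0 !mul0mx !addr0 add0r mulmx1 ?(V1, V2);
  by rewrite -scalar_mx_block.
Qed.

(** Induction on the list of eigenvalues: a unitary matrix whose first column is
an eigenvector for the head x turns B into diag(x, D), with D again hermitian
and char_poly D the product over the tail.  Since the head is always removed
first, the diagonal lists the eigenvalues in the order of s. *)
Lemma hermitian_spectral n s (B : 'M[K]_n) : conj_mx B = B ->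
    char_poly B = \prod_(x <- s) ('X - (real x)%:P) ->
  exists2 W : 'M[K]_n, unitary W &
    conj_mx W *m B *m W = diag_mx (\row_i real s`_i).
Proof.
elim: s n B => [|x s IHs] n B BH cB.
  have := congr1 (size \o polyseq) cB.
  rewrite /= size_char_poly size_prod_XsubC.
  case=> n0; exists 1%:M; first by split; rewrite conj_mx1 mulmx1.
  by apply/matrixP=> i; exfalso; case: i; rewrite n0.
case: n B BH cB => [|n] B BH cB.
  have := congr1 (size \o polyseq) cB.
  rewrite /= size_char_poly size_prod_XsubC.
  by [].
have xc : root (char_poly B) (real x).
  by rewrite cB big_cons rootM root_XsubC eqxx.
have /eigenvalueP[v vB v0] : eigenvalue B (real x).
  by rewrite eigenvalue_root_char.
have {v0} : conj_mx v != 0.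
  by apply: contraNneq v0 => vz; rewrite -(conj_mxK v) vz /conj_mx trmx0 map_mx0.
(* Eigenvectors are rows here; conjugating gives a column. *)
have {vB} : B *m conj_mx v = real x *: conj_mx v.
  by rewrite -{1}BH -conj_mxM vB conj_mxZ conj_of_real.
move: (conj_mx v) => {v xc}.
move: B BH cB; rewrite -[n.+1]add1n => B BH cB v Bv v0.
have [W Wu [c We]] := unitary_extension v0.
have [C defC] : exists C, C = conj_mx W *m B *m W.
  by exists (conj_mx W *m B *m W).
have CH : conj_mx C = C by rewrite defC !conj_mxM conj_mxK BH mulmxA.
have Ce : lsubmx C = col_mx (real x)%:M 0.
  have lM (M N : 'M[K]_(1 + n)) : lsubmx (M *m N) = M *m lsubmx N.
    by rewrite -{1}(hsubmxK N) mul_mx_row row_mxKl.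
  rewrite defC lM -mulmxA We -scalemxAr Bv scalerA mulrC -scalerA -We.
  rewrite -scalemxAr -lM Wu.1 scalar_mx_block.
  rewrite block_mxEh row_mxKl scale_col_mx.
  by rewrite scaler0 scale_scalar_mx mulr1.
pose D : 'M[K]_n := drsubmx C.
have Cdl : dlsubmx C = 0.
  apply/matrixP=> i j.
  have := congr1 (fun M : 'M_(1 + n, 1) => M (rshift 1 i) j) Ce.
  by rewrite col_mxEd !mxE.
have CE : C = block_mx (real x)%:M 0 0 D.
  rewrite -(submxK C) Cdl; congr block_mx.
    apply/matrixP=> i j.
    have := congr1 (fun M : 'M_(1 + n, 1) => M (lshift n i) j) Ce.
    by rewrite col_mxEu !mxE.
  apply/matrixP=> i j; have := congr1 (fun M : 'M_(n, 1) => conj (M j i)) Cdl.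
  by rewrite !mxE rmorph0 -conj_mxE CH.
have DH : conj_mx D = D.
  by apply/matrixP=> i j; rewrite conj_mxE !mxE -conj_mxE CH.
have cD : char_poly D = \prod_(y <- s) ('X - (real y)%:P).
  have := char_poly_conj B Wu; rewrite -defC CE cB big_cons.
  rewrite {1}/char_poly char_block_diag_mx det_ublock -/(char_poly D).
  rewrite det_mx11 !mxE eqxx mulr1n => /mulfI; apply.
  by rewrite polyXsubC_eq0.
have [V Vu VD] := IHs _ _ DH cD.
exists (W *m block_mx 1%:M 0 0 V); first exact: unitaryM Wu (unitary_block Vu).
have -> : conj_mx (W *m block_mx 1%:M 0 0 V) *m B *m (W *m block_mx 1%:M 0 0 V)
    = conj_mx (block_mx 1%:M 0 0 V) *m C *m block_mx 1%:M 0 0 V.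
  by rewrite defC conj_mxM !mulmxA.
rewrite CE /conj_mx tr_block_mx map_block_mx !trmx0 !map_mx0 trmx1 map_mx1.
rewrite -/(conj_mx V) !mulmx_block !mulmx0 !mul0mx !mulmx1 !mul1mx !addr0 !add0r.
rewrite mul0mx VD; apply/matrixP=> i j.
case: (split_ordP i) => i' ->; case: (split_ordP j) => j' ->.
- by rewrite block_mxEul !mxE !ord1 eqxx.
- by rewrite block_mxEur !mxE; case: eqP => // /(congr1 val) /= ; rewrite ord1.
- by rewrite block_mxEdl !mxE; case: eqP => // /(congr1 val) /= ; rewrite ord1.
- by rewrite block_mxEdr !mxE eq_rshift.
Qed.


(** * Truncated singular value decompositions *)

(** In a decreasing list of nonnegative numbers the positive ones come first;
beyond them both sides are 0, the default value of nth. *)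
Lemma nth_pos_part (s : seq R) i :
  sorted >=%R s -> all (fun x => 0 <= x) s -> (pos_part s)`_i = s`_i.
Proof.
rewrite /pos_part; elim: s i => [|x s IHs] i // ss /= /andP[x0 s0].
have [xp|xp] := ltP 0 x.
  by case: i => [|i] //=; apply: IHs => //; apply: path_sorted ss.
have z y : y \in x :: s -> y = 0.
  rewrite in_cons => /predU1P[->|ys]; first by apply/le_anti; rewrite xp x0.
  apply/le_anti; rewrite (allP s0 _ ys) andbT; apply: le_trans xp.
  have ge_trans : transitive (>=%R : rel R).
    by move=> a b c /= ba cb; apply: le_trans ba.
  exact: (allP (order_path_min ge_trans ss)).
have -> : [seq y <- s | 0 < y] = [::].
  apply/eqP; rewrite -(negbK (_ == _)) -has_filter; apply/hasPn => y ys.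
  by rewrite -leNgt (z y) // in_cons ys orbT.
rewrite nth_nil; have [lt_i|le_i] := ltnP i (size s).+1.
  by rewrite (z (_`_i)) // mem_nth.
by rewrite nth_default.
Qed.

Lemma pos_part_gt0 (s : seq R) i : (i < deg s)%N -> 0 < (pos_part s)`_i.
Proof.
rewrite /deg -size_filter => lt_i.
by have := mem_nth 0 lt_i; rewrite mem_filter => /andP[].
Qed.

Lemma diag_pos_unit r (s : seq R) : deg s = r -> diag_pos k r s \in unitmx.
Proof.
move=> sr; rewrite unitmxE det_diag unitfE prodf_seq_neq0; apply/allP => i _.
by rewrite mxE fmorph_eq0 gt_eqF // pos_part_gt0 // sr.
Qed.

Lemma conj_diag_pos r (s : seq R) : conj_mx (diag_pos k r s) = diag_pos k r s.
Proof. exact: conj_mx_diag. Qed.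

(** V consists of the first r columns of a unitary W diagonalizing M^H M, and
U = M V S^-1.  The remaining columns of W lie in the kernel of M because their
Gram matrix under M is the zero part of the spectrum; hence M V V^H = M. *)
Lemma svd_exists m n (M : 'M[K]_(m, n)) s r : singular_values M s -> deg s = r ->
  exists U V, truncated_svd M U (diag_pos k r s) V.
Proof.
move=> sM sr; have [ss s0 cM] := sM.
have [||W [W1 W2] WD] :=
  @hermitian_spectral n [seq x ^+ 2 | x <- s] (conj_mx M *m M).
- by rewrite conj_mxM conj_mxK.
- by rewrite cM big_map.
have size_s : size s = n.
  have := congr1 (size \o polyseq) cM.
  by rewrite /= size_char_poly size_prod_XsubC => -[].
have le_rn : (r <= n)%N by rewrite -sr -size_s count_size.
set S := diag_pos k r s; have Su : S \in unitmx := diag_pos_unit sr.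
pose V := W *m pid_mx r : 'M[K]_(n, r).
have VV : conj_mx V *m V = 1%:M.
  rewrite conj_mxM conj_mx_pid -mulmxA [_ *m (_ *m pid_mx r)]mulmxA W1 mul1mx.
  by rewrite pid_mx_id // pid_mx_1.
set D := diag_mx _ in WD.
have Dpid : D *m pid_mx r = pid_mx r *m (S *m S) :> 'M_(n, r).
  rewrite mulmx_diag mul_diag_mx mul_mx_diag; apply/matrixP=> i j; rewrite !mxE.
  case: eqP => [ij|_]; last by rewrite mulr0 mul0r.
  rewrite -ij nth_pos_part // (nth_map 0) ?size_s // expr2 rmorphM.
  by rewrite mulrC.
have Dcopid : D *m copid_mx r = 0.
  rewrite mul_diag_mx; apply/matrixP=> i j; rewrite !mxE.
  have [<-|ij] := eqVneq i j; last first.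
    by rewrite (_ : (i == j :> nat) = false) ?subrr ?mulr0 //; apply/negbTE.
  have [lt_ir|le_ri] := ltnP i r; first by rewrite eqxx subrr mulr0.
  rewrite (nth_map 0) ?size_s // -nth_pos_part // nth_default.
    by rewrite expr0n rmorph0 mul0r.
  by rewrite size_filter -/(deg s) sr.
have SS : conj_mx V *m (conj_mx M *m M) *m V = S *m S.
  have -> : conj_mx V *m (conj_mx M *m M) *m V
      = pid_mx r *m (conj_mx W *m (conj_mx M *m M) *m W *m pid_mx r).
    by rewrite conj_mxM conj_mx_pid !mulmxA.
  by rewrite WD Dpid mulmxA pid_mx_id // pid_mx_1 mul1mx.
have MV : M *m V *m conj_mx V = M.
  have Z0 : M *m W *m copid_mx r = 0.
    apply: gram_eq0; rewrite !conj_mxM -!mulmxA.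
    rewrite [conj_mx M *m _]mulmxA [conj_mx W *m _]mulmxA.
    by rewrite [conj_mx W *m _ *m _]mulmxA WD Dcopid mulmx0.
  rewrite conj_mxM conj_mx_pid !mulmxA -[M *m W *m _ *m _]mulmxA pid_mx_id //.
  have -> : pid_mx r = 1%:M - copid_mx r :> 'M[K]_n by rewrite opprB addrC subrK.
  by rewrite mulmxBr Z0 subr0 mulmx1 -mulmxA W2 mulmx1.
pose U := M *m V *m invmx S.
have USV : U *m S *m conj_mx V = M by rewrite /U mulmxKV.
have UU : conj_mx U *m U = 1%:M.
  have SVH : conj_mx (invmx S) = invmx S.
    by rewrite /conj_mx trmx_inv map_invmx -[map_mx _ _]/(conj_mx S) conj_diag_pos.
  have -> : conj_mx U *m U
      = invmx S *m (conj_mx V *m (conj_mx M *m M) *m V) *m invmx S.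
    by rewrite /U conj_mxM (conj_mxM M) SVH !mulmxA.
  by rewrite SS mulmxA mulVmx // mul1mx mulmxV.
clearbody U V; exists U, V; split=> //; last by exists s.
apply/eqP; rewrite eqn_leq; apply/andP; split; last first.
  by rewrite -USV -mulmxA; apply: leq_trans (mxrankM_maxl _ _) (rank_leq_col _).
have -> : r = \rank S by rewrite mxrank_unit.
have -> : S = conj_mx U *m M *m V.
  by rewrite -USV !mulmxA UU mul1mx -mulmxA VV mulmx1.
exact: leq_trans (mxrankM_maxl _ _) (mxrankM_maxr _ _).
Qed.

(** Entrywise, w i j (s_j^2 - s_i^2) = 0, and s_i + s_j > 0 can be cancelled. *)
Lemma comm_sqr_diag_pos r (s : seq R) (w : 'M[K]_r) : deg s = r ->
    w *m (diag_pos k r s *m diag_pos k r s)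
      = diag_pos k r s *m diag_pos k r s *m w ->
  w *m diag_pos k r s = diag_pos k r s *m w.
Proof.
move=> sr; rewrite /diag_pos mulmx_diag !mul_mx_diag !mul_diag_mx => E.
apply/matrixP=> i j; have := congr1 (fun M : 'M_r => M i j) E; rewrite !mxE.
set a := real _`_j; set b := real _`_i => ab.
have ab0 : a + b != 0.
  by rewrite -rmorphD fmorph_eq0 gt_eqF // addr_gt0 // pos_part_gt0 // sr.
apply: (mulfI ab0).
rewrite !mulrDl (mulrC a (_ * a)) -mulrA ab addrC -[b * b * _]mulrA.
by congr (_ + _); rewrite [RHS]mulrCA [w i j * a]mulrC.
Qed.

(** With w = U^H U' and x = V^H V', comparing both decompositions of M and of
M^H gives S x = w S and S w = x S.  So w commutes with S^2, hence with S, and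
then x = w. *)
Lemma svd_unique m n r (M : 'M[K]_(m, n)) U V U' V' (S : 'M[K]_r) :
    truncated_svd M U S V -> truncated_svd M U' S V' ->
  exists w, [/\ unitary w, w *m S = S *m w, U' = U *m w & V' = V *m w].
Proof.
move=> [_ MU U1 V1 [s _ [sr Ss]]] [_ MU' U'1 V'1 _].
have Su : S \in unitmx by rewrite Ss diag_pos_unit.
have SH : conj_mx S = S by rewrite Ss conj_diag_pos.
pose w := conj_mx U *m U'; pose x := conj_mx V *m V'.
have SVx : S *m x = w *m S.
  have := congr1 (fun M => conj_mx U *m M *m V') (etrans (esym MU) MU').
  by rewrite !mulmxA U1 mul1mx -!mulmxA V'1 mulmx1 !mulmxA.
have VSw : V *m S *m w = V' *m S.
  have := congr1 (fun M => conj_mx M *m U') (etrans (esym MU) MU').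
  by rewrite /= !conj_mxM !conj_mxK SH -!mulmxA U'1 mulmx1.
have Sw : S *m w = x *m S.
  by rewrite /x -mulmxA -VSw !mulmxA V1 mul1mx.
have Uw : U' = U *m w.
  apply: (can_inj (mulmxK Su)); rewrite -mulmxA -SVx /x !mulmxA -MU MU'.
  by rewrite -!mulmxA V'1 mulmx1.
have Vx : V' = V *m x.
  by apply: (can_inj (mulmxK Su)); rewrite -mulmxA -Sw mulmxA VSw.
have wU : unitary w.
  apply: orthonormal_unitary; rewrite /orthonormal_cols -U'1 [in RHS]Uw conj_mxM.
  by rewrite -mulmxA [conj_mx U *m _]mulmxA U1 mul1mx.
clearbody w x.
have wS : w *m S = S *m w.
  rewrite Ss; apply: comm_sqr_diag_pos => //; rewrite -Ss.
  by rewrite mulmxA -SVx -!mulmxA Sw.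
exists w; split=> //; rewrite Vx; congr (_ *m _).
by apply: (can_inj (mulKmx Su)); rewrite SVx wS.
Qed.

End ScalarTheory.

(** * Multi-indices *)

(** Co-lexicographic positions with a new fastest digit i in base a. *)
Lemma divn_cons a b i t : (i < a -> (i + a * t) %/ (a * b) = t %/ b)%N.
Proof.
move=> lt_i; have a_gt0 := leq_ltn_trans (leq0n i) lt_i.
by rewrite divnMA addnC mulnC divnMDl // (divn_small lt_i) addn0.
Qed.

Lemma modn_cons a b i t :
  (i < a -> (i + a * t) %% (a * b) = i + a * (t %% b))%N.
Proof.
move=> lt_i; have /(@divn_cons _ b _ t) E := lt_i.
have := divn_eq (i + a * t) (a * b); rewrite E {1}(divn_eq t b).
by rewrite mulnDr mulnCA addnCA => /addnI <-.
Qed.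

Section Indices.

Variables (n : nat -> nat) (d mu : nat).
Local Notation P := (\prod_(0 <= i < mu) n i)%N.
Local Notation Q := (\prod_(mu.+1 <= i < d) n i)%N.

Lemma colex_lt m1 m2 a b : (a < m1 -> b < m2 -> a + m1 * b < m1 * m2)%N.
Proof.
move=> lt_a lt_b; apply: leq_trans (_ : m1 * b.+1 <= _)%N.
  by rewrite mulnS ltn_add2r.
by rewrite leq_pmul2l // (leq_ltn_trans _ lt_a).
Qed.

Lemma snoc_index_subproof (t : 'I_P) (i : 'I_(n mu)) :
  (t + P * i < \prod_(0 <= j < mu.+1) n j)%N.
Proof. by rewrite [X in (_ < X)%N]big_nat_recr //= colex_lt. Qed.

Definition snoc_index (i : 'I_(n mu)) (t : 'I_P) :
    'I_(\prod_(0 <= j < mu.+1) n j) := Ordinal (snoc_index_subproof t i).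

Lemma cons_index_subproof (lt_mu_d : (mu < d)%N) (i : 'I_(n mu)) (u : 'I_Q) :
  (i + n mu * u < \prod_(mu <= j < d) n j)%N.
Proof. by rewrite [X in (_ < X)%N]big_ltn // colex_lt. Qed.

Definition cons_index (lt_mu_d : (mu < d)%N) (i : 'I_(n mu)) (u : 'I_Q) :
    'I_(\prod_(mu <= j < d) n j) := Ordinal (cons_index_subproof lt_mu_d i u).

(** Every position below mu.+1 modes arises by appending a digit. *)
Lemma eq_rowsub_snoc (T : Type) q (M N : 'M[T]_(\prod_(0 <= j < mu.+1) n j, q)) :
  (forall i, rowsub (snoc_index i) M = rowsub (snoc_index i) N) -> M = N.
Proof.
move=> MN; apply/matrixP=> t j.
have eqPn : (\prod_(0 <= j < mu.+1) n j = P * n mu)%N by rewrite big_nat_recr.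
pose t' := cast_ord eqPn t.
have := congr1 (fun X : 'M_(_, q) => X (colex_fst t') j) (MN (colex_snd t')).
have -> : t = snoc_index (colex_snd t') (colex_fst t').
  by apply: val_inj; rewrite /= addnC mulnC -divn_eq.
by rewrite !mxE.
Qed.

(** Every position in the modes from mu on arises by prepending a digit. *)
Lemma eq_colsub_cons (lt_mu_d : (mu < d)%N) (T : Type) q
    (M N : 'M[T]_(q, \prod_(mu <= j < d) n j)) :
  (forall i, colsub (cons_index lt_mu_d i) M = colsub (cons_index lt_mu_d i) N) ->
  M = N.
Proof.
move=> MN; apply/matrixP=> j u.
have eqnQ : (\prod_(mu <= j < d) n j = n mu * Q)%N by rewrite big_ltn.
pose u' := cast_ord eqnQ u.
have := congr1 (fun X : 'M_(q, _) => X j (colex_snd u')) (MN (colex_fst u')).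
have -> : u = cons_index lt_mu_d (colex_fst u') (colex_snd u').
  by apply: val_inj; rewrite /= addnC mulnC -divn_eq.
by rewrite !mxE.
Qed.

Lemma multi_index_shift (lt_mu_d : (mu < d)%N) t i (u : 'I_Q) :
  multi_index (snoc_index i t) u = multi_index t (cons_index lt_mu_d i u).
Proof.
apply/ffunP=> j; rewrite !ffunE; apply: val_inj; rewrite /= /multi_digit.
have [lt_j|gt_j|eq_j] := ltngtP j mu.
- have -> : (j < mu.+1)%N by apply: leqW.
  have PE : (P = \prod_(0 <= l < j) n l * (n j * \prod_(j.+1 <= l < mu) n l))%N.
    rewrite (big_cat_nat (n := j) (leq0n j) (ltnW lt_j)) /=.
    by rewrite [X in (_ * X)%N]big_ltn.
  have Pj_gt0 : (0 < \prod_(0 <= l < j) n l)%N.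
    have := leq_ltn_trans (leq0n t) (ltn_ord t).
    by rewrite PE muln_gt0 => /andP[].
  rewrite [X in (_ + X * _)%N]PE -mulnA [in LHS]addnC [in LHS]mulnC divnMDl //.
  by rewrite -mulnA [in LHS]mulnC modnMDl.
- by rewrite ltnS leqNgt gt_j /= [X in (_ = (_ %/ X) %% _)%N]big_ltn // divn_cons.
- have P_gt0 := leq_ltn_trans (leq0n t) (ltn_ord t).
  rewrite eq_j ltnSn [X in (_ = (_ %/ X) %% _)%N]big_geq // divn1.
  rewrite [in LHS]addnC [in LHS]mulnC divnMDl // (divn_small (ltn_ord t)) addn0.
  by rewrite addnC mulnC modnMDl.
Qed.

End Indices.

(** Moving mode mu across the bond leaves the underlying multi-index of the
tensor unchanged. *)
Lemma matricization_shift (R : rcfType) (k : scalar_kind) d n (A : tensor R k d n)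
    mu (lt_mu_d : (mu < d)%N) i :
  rowsub (snoc_index i) (matricization mu.+1 A)
    = colsub (cons_index lt_mu_d i) (matricization mu A).
Proof. by apply/matrixP=> t u; rewrite !mxE multi_index_shift. Qed.

(** * Chains of cores *)

Section Chains.

Variables (R : rcfType) (k : scalar_kind) (n r : nat -> nat).
Variable H : forall i, core R k (n i) (r i) (r i.+1).
Local Notation K := (scalar_field R k).
Local Notation chain s l := (@chain R k n r H s l).

Lemma chain_size_cons s l : chain_size n s l.+1 = (n s * chain_size n s.+1 l)%N.
Proof.
by elim: l => [|l IHl] /=; [rewrite mul1n muln1 | rewrite -addSnnS mulnA -IHl].
Qed.

(** Equal bond numbers need not be convertible, so products of cores carry casts;
this lets a cast pass the next core of the chain. *)
Lemma mul_cast_core m m' (e : m = m') a (C : 'M[K]_(a, r m))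
    (i : 'I_(n m)) (i' : 'I_(n m')) :
    i = i' :> nat ->
  castmx (erefl, congr1 r e) C *m H i'
    = castmx (erefl, congr1 (r \o S) e) (C *m H i).
Proof. by case: m' / e i' => i' /val_inj ->; rewrite !castmx_id. Qed.

(** Chains grow at the right end by definition; associativity lets them also be
unfolded at the left end, which the right interfaces require. *)
Lemma chain_cons s l (i : 'I_(n s)) (t : 'I_(chain_size n s l.+1))
    (t' : 'I_(chain_size n s.+1 l)) (e : (l + s.+1 = l.+1 + s)%N) :
    t = (i + n s * t')%N :> nat ->
  chain s l.+1 t = castmx (erefl, congr1 r e) (H i *m chain s.+1 l t').
Proof.
elim: l t t' e => [|l IHl] t t' e E.
  rewrite (eq_irrelevance (congr1 r e) erefl) castmx_id /= /boxprod mul1mx mulmx1.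
  have t'0 : t' = 0%N :> nat by case: (t') => [[]].
  by congr (H _); apply: val_inj; rewrite /= E divn1 t'0 muln0 addn0.
rewrite -[LHS]/(chain s l.+1 (colex_fst t) *m @H (l.+1 + s)%N (colex_snd t)).
have e' : (l + s.+1 = l.+1 + s)%N by rewrite addnS.
have Efst : colex_fst t = (i + n s * colex_fst t')%N :> nat.
  by rewrite -[RHS]/(i + n s * (t' %% chain_size n s.+1 l))%N -modn_cons //
    -chain_size_cons -E.
have Esnd : colex_snd t' = colex_snd t :> nat.
  by rewrite -[LHS]/(t' %/ chain_size n s.+1 l)%N
    -(divn_cons _ _ (ltn_ord i)) -chain_size_cons -E.
rewrite (IHl _ (colex_fst t') e' Efst) (mul_cast_core e' _ Esnd).
rewrite [in RHS]/= /boxprod mulmxA; congr (castmx (_, _) _).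
exact: eq_irrelevance.
Qed.

End Chains.

Lemma castmx_mulr (R : pzSemiRingType) m p q q' (e : q = q') (M : 'M[R]_(m, p))
    (N : 'M[R]_(p, q)) :
  castmx (erefl, e) (M *m N) = M *m castmx (erefl, e) N.
Proof. by case: q' / e; rewrite !castmx_id. Qed.

Section Interfaces.

Variables (R : rcfType) (k : scalar_kind) (d : nat) (n : nat -> nat).
Variables (sigma : nat -> seq R) (G : cores k d n sigma).
Local Notation K := (scalar_field R k).
Local Notation r := (tt_rank d sigma).
Local Notation lchain s l := (@chain R k n r (@left_factor R k d n sigma G) s l).
Local Notation rchain s l := (@chain R k n r (@right_factor R k d n sigma G) s l).

(** Since r 0 = 1, each row of the left interface is a whole matrix of the
chain. *)
Lemma left_interfaceE mu (t : 'I_(\prod_(0 <= i < mu) n i))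
    (a : 'I_(chain_size n 0 mu)) q : t = a :> nat ->
  left_interface G mu t q
    = castmx (erefl, congr1 r (addn0 mu)) (lchain 0 mu a) ord0 q.
Proof.
move=> ta; rewrite /left_interface castmxE mxE [RHS]castmxE /=.
set t' := cast_ord _ t; have -> : colex_snd t' = a.
  by apply: val_inj; rewrite /= divn1.
by congr (lchain 0 mu a _ _); apply: val_inj; rewrite /= modn1.
Qed.

Lemma left_interface0 : left_interface G 0 = const_mx 1.
Proof.
apply/matrixP=> t q; have lt1 : (t < 1)%N.
  by apply: leq_trans (ltn_ord t) _; rewrite big_geq.
rewrite (@left_interfaceE 0 t (Ordinal lt1)) //.
by rewrite (eq_irrelevance (congr1 r _) erefl) castmx_id /= !mxE; case: q => [[]].
Qed.

Lemma left_interface_snoc mu i :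
  rowsub (snoc_index i) (left_interface G mu.+1)
    = left_interface G mu *m left_factor G i.
Proof.
apply/matrixP=> t q; rewrite mxE.
have eP : (\prod_(0 <= i < mu) n i = chain_size n 0 mu)%N.
  by rewrite chain_sizeE addn0.
pose a : 'I_(chain_size n 0 mu) := cast_ord eP t.
have ei : n mu = n (mu + 0)%N by rewrite addn0.
pose i' : 'I_(n (mu + 0)%N) := cast_ord ei i.
have lt_a : (a + chain_size n 0 mu * i' < chain_size n 0 mu.+1)%N.
  exact: colex_lt.
rewrite (@left_interfaceE _ _ (Ordinal lt_a)); last by rewrite /= -eP.
have -> : lchain 0 mu.+1 (Ordinal lt_a) = lchain 0 mu a *m left_factor G i'.
  rewrite -[LHS]/(lchain 0 mu _ *m left_factor G _).
  have gt0 := leq_ltn_trans (leq0n _) (ltn_ord a).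
  congr (lchain 0 mu _ *m left_factor G _); apply: val_inj => /=.
    by rewrite addnC mulnC modnMDl (modn_small (ltn_ord a)).
  by rewrite addnC mulnC divnMDl // (divn_small (ltn_ord a)) addn0.
rewrite (eq_irrelevance (congr1 r (addn0 mu.+1)) (congr1 (r \o S) (addn0 mu))).
rewrite -(@mul_cast_core _ _ _ _ (@left_factor R k d n sigma G) _ _ (addn0 mu) _
  _ i' i) // !mxE.
by apply: eq_bigr => l _; rewrite (@left_interfaceE _ t a).
Qed.

(** Dually r d = 1, so each column of the right interface is a matrix of the
chain.  The length l is kept apart from d - mu, so that the recursion from mu
to mu.+1 can use l.+1 and l. *)
Lemma right_interfaceE mu (le_mu_d : (mu <= d)%N) l (e : (l + mu = d)%N)
    (u : 'I_(\prod_(mu <= i < d) n i)) (a : 'I_(chain_size n mu l)) j q :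
    u = a :> nat ->
  right_interface G le_mu_d j u = castmx (erefl, congr1 r e) (rchain mu l a) j q.
Proof.
have el : l = (d - mu)%N by rewrite -e addnK.
subst l => ua; rewrite /right_interface castmxE mxE [RHS]castmxE /=.
have r1 : r (d - mu + mu) = 1%N by rewrite e tt_rank_last.
set u' := cast_ord _ u; rewrite !cast_ord_id.
have -> : colex_snd u' = a by apply: val_inj; rewrite /= r1 divn1.
congr (rchain mu _ a j _); apply: val_inj; rewrite /= r1 modn1.
by case: q => [[|q] lt_q] //; exfalso; move: lt_q; rewrite tt_rank_last.
Qed.

Definition last_bond : 'I_(r d) := cast_ord (esym (tt_rank_last d sigma)) ord0.

Lemma right_interface_last (le_d_d : (d <= d)%N) :
  right_interface G le_d_d = const_mx 1.
Proof.
apply/matrixP=> j u; have lt1 : (u < 1)%N.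
  by apply: leq_trans (ltn_ord u) _; rewrite big_geq.
rewrite (@right_interfaceE d _ 0 erefl u (Ordinal lt1) j last_bond) //.
rewrite castmx_id !mxE.
have -> // : j = last_bond.
apply: val_inj; rewrite /=; apply/eqP; rewrite -leqn0 -ltnS -(tt_rank_last d sigma).
exact: ltn_ord.
Qed.

Lemma right_interface_cons mu (lt_mu_d : (mu < d)%N) i :
  colsub (cons_index lt_mu_d i) (right_interface G (ltnW lt_mu_d))
    = right_factor G i *m right_interface G lt_mu_d.
Proof.
apply/matrixP=> j u; rewrite mxE; set l := (d - mu.+1)%N.
have el : (l + mu.+1 = d)%N by rewrite subnK.
have el1 : (l.+1 + mu = d)%N by rewrite addSnnS.
have eQ : (\prod_(mu.+1 <= i < d) n i = chain_size n mu.+1 l)%N.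
  by rewrite chain_sizeE el.
pose a : 'I_(chain_size n mu.+1 l) := cast_ord eQ u.
have lt_a : (i + n mu * a < chain_size n mu l.+1)%N.
  by rewrite chain_size_cons colex_lt.
rewrite (@right_interfaceE _ _ _ el1 _ (Ordinal lt_a) _ last_bond) //.
have e : (l + mu.+1 = l.+1 + mu)%N by rewrite addnS.
rewrite (@chain_cons _ _ _ _ _ _ _ i _ a e) // castmx_comp.
rewrite (eq_irrelevance (etrans _ (congr1 r el1)) (congr1 r el)).
rewrite (eq_irrelevance (etrans _ _) erefl) castmx_mulr !mxE.
by apply: eq_bigr => q _; rewrite (@right_interfaceE _ _ _ el _ a _ last_bond).
Qed.

End Interfaces.

(** * Singular value decompositions at all bonds *)

Lemma mul_const_mx1 (R : pzSemiRingType) m p q : p = 1%N ->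
  (const_mx 1 : 'M[R]_(m, p)) *m (const_mx 1 : 'M[R]_(p, q)) = const_mx 1.
Proof.
by move->; apply/matrixP=> i j; rewrite !mxE big_ord1 !mxE mulr1.
Qed.

Lemma const_mx1_eq1 (R : pzSemiRingType) m :
  m = 1%N -> const_mx 1 = 1%:M :> 'M[R]_m.
Proof. by move->; apply/matrixP=> i j; rewrite !mxE !ord1. Qed.

Lemma family_choice (I : Type) (F : I -> Type) (P : forall i, F i -> Prop) :
    (forall i, exists x, P i x) ->
  exists f : forall i, F i, forall i, P i (f i).
Proof.
by move=> H; exists (fun i => projT1 (cid (H i))) => i; apply: projT2 (cid (H i)).
Qed.

Section Bonds.

Variables (R : rcfType) (k : scalar_kind) (d : nat) (n : nat -> nat).
Variables (A : tensor R k d n) (sigma : nat -> seq R).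
Hypothesis d_gt0 : (0 < d)%N.
Local Notation K := (scalar_field R k).
Local Notation r := (tt_rank d sigma).

Lemma conj_mx_const1 m p : conj_mx (const_mx 1 : 'M[K]_(m, p)) = const_mx 1.
Proof. by rewrite /conj_mx trmx_const map_const_mx rmorph1. Qed.

(** The weight 1 at the end bonds absorbs the case distinctions in left_factor and
right_factor. *)
Definition bond_weight mu : 'M[K]_(r mu) :=
  if (mu == 0%N) || (mu == d) then 1%:M else Sigma k d sigma mu.
Local Notation T := bond_weight.

Lemma bond_weightE mu : (0 < mu < d)%N -> T mu = Sigma k d sigma mu.
Proof.
by move=> /andP[mu0 mud]; rewrite /T gtn_eqF // ltn_eqF.
Qed.

Lemma deg_tt_rank mu : (0 < mu < d)%N -> deg (sigma mu) = r mu.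
Proof.
by move=> /andP[mu0 mud]; rewrite /tt_rank gtn_eqF // ltn_eqF.
Qed.

Lemma end_or_inner mu : (mu <= d)%N -> [\/ mu = 0, mu = d | (0 < mu < d)%N]%N.
Proof.
case: mu => [|mu]; first by constructor 1.
by rewrite leq_eqVlt => /predU1P[]; [constructor 2 | constructor 3].
Qed.

Lemma bond_weight_end mu : mu = 0%N \/ mu = d -> T mu = 1%:M.
Proof. by rewrite /T => -[] ->; rewrite eqxx ?orbT. Qed.

Lemma bond_weight_unit mu : (mu <= d)%N -> T mu \in unitmx.
Proof.
case/end_or_inner=> E; last first.
- by rewrite bond_weightE // diag_pos_unit // deg_tt_rank.
- by rewrite bond_weight_end ?unitmx1 //; right.
- by rewrite bond_weight_end ?unitmx1 //; left.
Qed.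

Lemma left_factorE (G : cores k d n sigma) mu i : (mu < d)%N ->
  left_factor G i = T mu *m G mu i.
Proof.
move=> lt_mu_d; rewrite /left_factor /T (ltn_eqF lt_mu_d) orbF.
by case: eqP => // _; rewrite mul1mx.
Qed.

Lemma right_factorE (G : cores k d n sigma) mu i :
  right_factor G i = G mu i *m T mu.+1.
Proof. by rewrite /right_factor /T /=; case: eqP => // _; rewrite mulmx1. Qed.

(** A truncated singular value decomposition, extended to the bonds 0 and d by the
trivial factorizations, where only one factor needs to be orthonormal. *)
Definition bond_svd mu (U : 'M[K]_(\prod_(0 <= i < mu) n i, r mu))
    (V : 'M[K]_(r mu, \prod_(mu <= i < d) n i)) : Prop :=
  [/\ matricization mu A = U *m T mu *m V,
      (mu < d)%N -> conj_mx U *m U = 1%:M,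
      (0 < mu)%N -> V *m conj_mx V = 1%:M,
      (mu = 0%N -> U = const_mx 1) /\ (mu = d -> V = const_mx 1)
    & (0 < mu < d)%N ->
        truncated_svd (matricization mu A) U (Sigma k d sigma mu) (conj_mx V)].

(** At an end bond one of the two index sets has a single element, and a matrix
of ones with a single row or column serves as the trivial factor. *)
Lemma bond_svd_exists (hsigma : tt_singular_values A sigma) mu :
  (mu <= d)%N -> exists UV, bond_svd (mu := mu) UV.1 UV.2.
Proof.
case/end_or_inner=> E.
- subst mu; have P1 : (\prod_(0 <= i < 0) n i = 1)%N by rewrite big_geq.
  exists (const_mx 1, const_mx 1 *m matricization 0 A) => /=; split=> //.
  + rewrite bond_weight_end; last by left.
    by rewrite mulmx1 mulmxA mul_const_mx1 // const_mx1_eq1 // mul1mx.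
  + by rewrite conj_mx_const1 mul_const_mx1 // const_mx1_eq1.
  + by split=> // E; exfalso; move: d_gt0; rewrite -E.
- subst mu; have Q1 : (\prod_(d <= i < d) n i = 1)%N by rewrite big_geq.
  have rd : r d = 1%N by exact: tt_rank_last.
  exists (matricization d A *m const_mx 1, const_mx 1) => /=; split=> //.
  + rewrite bond_weight_end; last by right.
    by rewrite mulmx1 -mulmxA mul_const_mx1 // const_mx1_eq1 // mulmx1.
  + by rewrite ltnn.
  + by rewrite conj_mx_const1 mul_const_mx1 // const_mx1_eq1.
  + by split=> // E; exfalso; move: d_gt0; rewrite E.
  + by rewrite ltnn andbF.
have [U [V UV]] := svd_exists (hsigma mu E) (deg_tt_rank E).
have [_ AE U1 V1 _] := UV.
exists (U, conj_mx V); split=> //=.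
- by rewrite bond_weightE.
- by rewrite conj_mxK.
- by split=> e; exfalso; move: E; rewrite e ?ltnn ?andbF.
- by rewrite conj_mxK.
Qed.

Section Assembly.

Variable U : forall mu, 'M[K]_(\prod_(0 <= i < mu) n i, r mu).
Variable V : forall mu, 'M[K]_(r mu, \prod_(mu <= i < d) n i).
Hypothesis UV : forall mu, (mu <= d)%N -> bond_svd (U mu) (V mu).

(** The only solution of the left recursion
U_(mu+1) = U_mu T_mu G_mu on the rows with digit i. *)
Definition svd_cores : cores k d n sigma := fun mu i =>
  invmx (T mu) *m conj_mx (U mu) *m rowsub (snoc_index i) (U mu.+1).

Lemma svd_cores_left mu : (mu <= d)%N -> left_interface svd_cores mu = U mu.
Proof.
elim: mu => [|mu IHmu] le_mu_d.
  by rewrite left_interface0; have [_ _ _ [-> //]] := UV le_mu_d.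
apply: eq_rowsub_snoc => i.
rewrite left_interface_snoc IHmu ?(ltnW le_mu_d) // left_factorE // /svd_cores.
have Tu := bond_weight_unit (ltnW le_mu_d).
have Tu' := bond_weight_unit le_mu_d.
have [AE UU _ _ _] := UV (ltnW le_mu_d).
have [AE' _ VV' _ _] := UV le_mu_d.
(* The columns of U mu.+1 lie in the column space of the matricization. *)
have -> : U mu.+1 = matricization mu.+1 A *m conj_mx (V mu.+1) *m invmx (T mu.+1).
  by rewrite AE' -!mulmxA [V _ *m _]mulmxA VV' // mul1mx mulmxV // mulmx1.
rewrite -!mul_rowsub_mx (matricization_shift A le_mu_d) AE -mulmx_colsub.
by rewrite !mulmxA mulmxK // -[_ *m conj_mx _ *m U mu]mulmxA UU // mulmx1.
Qed.

(** Descending induction from the bond d: the product of the core with the next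
right factor is T^-1 U^H applied to columns of the matricization at mu. *)
Lemma svd_cores_right mu (le_mu_d : (mu <= d)%N) :
  right_interface svd_cores le_mu_d = V mu.
Proof.
have [l ld] : exists l, (l + mu = d)%N by exists (d - mu)%N; rewrite subnK.
elim: l mu ld le_mu_d => [|l IHl] mu ld le_mu_d.
  rewrite add0n in ld; subst mu.
  by rewrite right_interface_last; have [_ _ _ [_ -> //]] := UV le_mu_d.
have lt_mu_d : (mu < d)%N by rewrite -ld addSn ltnS leq_addl.
apply: (eq_colsub_cons (lt_mu_d := lt_mu_d)) => i.
rewrite (bool_irrelevance le_mu_d (ltnW lt_mu_d)) right_interface_cons.
rewrite IHl ?addnS // right_factorE /svd_cores.
have Tu := bond_weight_unit le_mu_d.
have [AE UU _ _ _] := UV le_mu_d.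
have [AE' _ _ _ _] := UV lt_mu_d.
rewrite -!mulmxA [rowsub _ _ *m _]mulmxA !mul_rowsub_mx -AE'.
rewrite (matricization_shift A lt_mu_d) AE -mulmx_colsub -!mulmxA.
by rewrite [conj_mx _ *m _]mulmxA UU // mul1mx mulKmx.
Qed.

Lemma svd_cores_tt_svd : tt_svd A svd_cores.
Proof.
move=> mu mu0 lt_mu_d; have le_mu_d := ltnW lt_mu_d.
rewrite svd_cores_left // svd_cores_right.
by have [_ _ _ _] := UV le_mu_d; apply; rewrite mu0.
Qed.

End Assembly.

Lemma tt_svd_exists : tt_singular_values A sigma ->
  exists G : cores k d n sigma, tt_svd A G.
Proof.
move=> hsigma.
have H mu : exists UV, (mu <= d)%N -> bond_svd (mu := mu) UV.1 UV.2.
  have [le_mu_d|] := leqP mu d; last by exists (0, 0).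
  by have [UV ?] := bond_svd_exists hsigma le_mu_d; exists UV.
have [UV UVP] := family_choice H; exists (svd_cores (fun mu => (UV mu).1)).
exact: (@svd_cores_tt_svd _ (fun mu => (UV mu).2)).
Qed.

(** * Uniqueness up to a gauge *)

Lemma left_interface_orthonormal (G : cores k d n sigma) mu :
  tt_svd A G -> (mu < d)%N -> orthonormal_cols (left_interface G mu).
Proof.
move=> GA; case: mu => [|mu] lt_mu_d; last by have [] := GA mu.+1 isT lt_mu_d.
rewrite left_interface0 /orthonormal_cols conj_mx_const1 mul_const_mx1.
  by rewrite const_mx1_eq1.
by rewrite big_geq.
Qed.

Lemma right_interface_last_orthonormal (G : cores k d n sigma) mu
    (le_mu_d : (mu <= d)%N) : mu = d ->
  right_interface G le_mu_d *m conj_mx (right_interface G le_mu_d) = 1%:M.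
Proof.
move=> E; subst mu; rewrite right_interface_last conj_mx_const1 mul_const_mx1.
  by rewrite const_mx1_eq1 // tt_rank_last.
by rewrite big_geq.
Qed.

(** The two families may differ at each inner bond by the unitary of svd_unique;
at the end bonds the trivial interface, left at 0 and right at d, is the same
matrix of ones for both, so w = 1. *)
Lemma bond_gauge (G G' : cores k d n sigma) mu (le_mu_d : (mu <= d)%N) :
    tt_svd A G -> tt_svd A G' ->
  exists w : 'M[K]_(r mu),
    [/\ unitary w, w *m T mu = T mu *m w, (mu = 0%N \/ mu = d -> w = 1%:M),
        ((mu < d)%N -> left_interface G' mu = left_interface G mu *m w)
      & ((0 < mu)%N ->
          right_interface G' le_mu_d = conj_mx w *m right_interface G le_mu_d)].
Proof.
move=> GA G'A; have unit1 m : unitary (1%:M : 'M[K]_m).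
  by split; rewrite conj_mx1 mulmx1.
case/end_or_inner: (le_mu_d) => E.
- exists 1%:M; rewrite mul1mx mulmx1; subst mu; split=> //.
  by rewrite !left_interface0 mulmx1.
- exists 1%:M; rewrite mul1mx mulmx1; subst mu; split=> //; rewrite ?ltnn //.
  by rewrite !right_interface_last conj_mx1 mul1mx.
have /andP[mu0 lt_mu_d] := E.
have [w [wU wS LE RE]] := svd_unique (GA _ mu0 lt_mu_d) (G'A _ mu0 lt_mu_d).
exists w; split=> //.
- by rewrite bond_weightE.
- by case=> e; exfalso; move: E; rewrite e ?ltnn ?andbF.
- move=> _; rewrite -[LHS]conj_mxK (bool_irrelevance le_mu_d (ltnW lt_mu_d)) RE.
  by rewrite conj_mxM conj_mxK.
Qed.

(** Below the last mode the left recursions give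
U T (w G') = U T (G w_next), and U T has a left inverse.  The left factor at
the bond d need not be orthonormal, so the last mode uses the right recursion
instead. *)
Lemma tt_svd_unique (G G' : cores k d n sigma) : (1 < d)%N ->
    tt_svd A G -> tt_svd A G' ->
  exists w : forall mu, 'M[K]_(r mu),
    [/\ w 0%N = 1%:M, w d = 1%:M,
        forall mu, (0 < mu < d)%N ->
          unitary (w mu) /\
          w mu *m Sigma k d sigma mu = Sigma k d sigma mu *m w mu
      & forall mu, (mu < d)%N -> forall i : 'I_(n mu),
          G' mu i = conj_mx (w mu) *m G mu i *m w mu.+1].
Proof.
move=> d_gt1 GA G'A.
have H mu : exists w : 'M[K]_(r mu), forall le_mu_d : (mu <= d)%N,
    [/\ unitary w, w *m T mu = T mu *m w, (mu = 0%N \/ mu = d -> w = 1%:M),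
        ((mu < d)%N -> left_interface G' mu = left_interface G mu *m w)
      & ((0 < mu)%N ->
          right_interface G' le_mu_d = conj_mx w *m right_interface G le_mu_d)].
  have /orP[le_mu_d|gt_mu_d] := orbN (mu <= d)%N.
    have [w wP] := bond_gauge le_mu_d GA G'A; exists w => le'.
    by rewrite (bool_irrelevance le' le_mu_d).
  by exists 0 => le_mu_d; rewrite le_mu_d in gt_mu_d.
have [w wP] := family_choice H.
exists w; split.
- by have [_ _ w1 _ _] := wP _ (leq0n d); apply: w1; left.
- by have [_ _ w1 _ _] := wP _ (leqnn d); apply: w1; right.
- move=> mu E; have /andP[_ /ltnW le_mu_d] := E.
  by have [wU wT _ _ _] := wP _ le_mu_d; rewrite bond_weightE in wT.
move=> mu lt_mu_d i.
have [[wU1 wU2] wT _ LE RE] := wP _ (ltnW lt_mu_d).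
have [_ _ w1 LE' RE'] := wP _ lt_mu_d.
have [lt_mu1_d|ge_mu1_d] := ltnP mu.+1 d.
  have := congr1 (rowsub (snoc_index i)) (LE' lt_mu1_d).
  rewrite -mul_rowsub_mx !left_interface_snoc !left_factorE // LE //.
  rewrite !mulmxA -[_ *m w mu *m T mu]mulmxA wT.
  have Tu := bond_weight_unit (ltnW lt_mu_d).
  move/(congr1 (fun M => invmx (T mu) *m (conj_mx (left_interface G mu) *m M))).
  have LL := left_interface_orthonormal GA lt_mu_d.
  have LK p : cancel (@mulmx _ _ _ p (left_interface G mu))
      (mulmx (conj_mx (left_interface G mu))).
    by move=> M; rewrite mulmxA LL mul1mx.
  rewrite -!mulmxA !LK !mulKmx //.
  by move/(congr1 (mulmx (conj_mx (w mu)))); rewrite !mulmxA wU1 mul1mx.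
have mu1_d : mu.+1 = d by apply/eqP; rewrite eqn_leq lt_mu_d.
have mu0 : (0 < mu)%N by rewrite -ltnS mu1_d.
have := congr1 (colsub (cons_index lt_mu_d i)) (RE mu0).
rewrite -mulmx_colsub !right_interface_cons !right_factorE RE' //.
rewrite w1; last by right.
rewrite conj_mx1 mul1mx mulmx1 bond_weight_end ?mulmx1; last by right.
have RR : right_interface G lt_mu_d *m conj_mx (right_interface G lt_mu_d) = 1%:M.
  exact: right_interface_last_orthonormal.
move/(congr1 (mulmxr (conj_mx (right_interface G lt_mu_d)))) => /=.
by rewrite -!mulmxA RR !mulmx1.
Qed.

End Bonds.

Theorem proposition2p4 (R : realType) (k : scalar_kind) (d : nat) (hd : (2 <= d)%N)
    (n : nat -> nat) (A : tensor R k d n) (hA : A != 0)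
    (sigma : nat -> seq R) (hsigma : tt_singular_values A sigma) :
  exists G : cores k d n sigma,
    tt_svd A G /\
    forall G' : cores k d n sigma, tt_svd A G' ->
      exists w : forall mu : nat, 'M[scalar_field R k]_(tt_rank d sigma mu),
        [/\ w 0%N = 1%:M,
            w d = 1%:M,
            forall mu, (0 < mu < d)%N ->
              unitary (w mu) /\
              w mu *m Sigma k d sigma mu = Sigma k d sigma mu *m w mu
          & forall mu, (mu < d)%N -> forall i : 'I_(n mu),
              G' mu i = conj_mx (w mu) *m G mu i *m w mu.+1].
Proof.
have [G GA] := tt_svd_exists (ltnW hd) hsigma.
by exists G; split=> // G' G'A; apply: tt_svd_unique GA G'A.
Qed.
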